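(* Let $X$ be a completely metrizable space. Then $C_p(X)$ is an Ascoli space if and only if $X$ is scattered. If, moreover, $X$ is completely metrizable and separable, then $C_p(X)$ is an Ascoli space if and only if $X$ is scattered and countable.
   Context: For a Tychonoff space $Y$, $C_p(Y)$ and $C_k(Y)$ denote the set $C(Y)$ of all continuous real-valued functions on $Y$ with the topology of pointwise convergence and the compact-open topology, respectively. A Tychonoff space $Y$ is called Ascoli if every compact subset $\mathcal K$ of $C_k(Y)$ is evenly continuous, i.e. the evaluation map $Y\times\mathcal K\to\mathbb R$, $(y,f)\mapsto f(y)$, is continuous. A space is scattered if each of its nonempty subspaces has an isolated point. *)

(* Defs.v *)
From HB Require Import structures.
From mathcomp Require Import all_boot all_order all_algebra.
From mathcomp Require Import all_classical all_reals all_analysis.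

Set Implicit Arguments.
Unset Strict Implicit.
Unset Printing Implicit Defensive.

Import Order.TTheory GRing.Theory Num.Theory.
Import numFieldNormedType.Exports.

Local Open Scope classical_set_scope.
Local Open Scope ring_scope.

Definition is_metric (R : realType) (T : Type) (d : T -> T -> R) : Prop :=
  [/\ forall x y, d x y = 0 <-> x = y,
      forall x y, d x y = d y x &
      forall x y z, d x z <= d x y + d y z].

Definition induces_topology (R : realType) (X : topologicalType)
    (d : X -> X -> R) : Prop :=
  forall (x : X) (A : set X),
    nbhs x A <-> exists2 e : R, 0 < e & [set y | d x y < e] `<=` A.

Definition cauchy_seq (R : realType) (T : Type) (d : T -> T -> R)
    (u : nat -> T) : Prop :=
  forall e : R, 0 < e ->
    exists N : nat, forall m n : nat, (N <= m)%N -> (N <= n)%N ->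
      d (u m) (u n) < e.

(* A property of the topology alone: the metric is existentially quantified
   instead of being part of the structure, as it would be with [metricType].
   The library's [completeType] is moreover pointed, which would exclude the
   empty space. *)
Definition completely_metrizable (R : realType) (X : topologicalType) : Prop :=
  exists d : X -> X -> R,
    [/\ is_metric d,
        induces_topology d &
        forall u : nat -> X, cauchy_seq d u -> exists l : X, u @ \oo --> l].

Definition separable (X : topologicalType) : Prop :=
  exists2 D : set X, countable D & dense D.

Definition scattered (X : topologicalType) : Prop :=
  forall A : set X, A !=set0 -> isolated A !=set0.

Definition tychonoff_space (X : topologicalType) : Prop :=
  completely_regular_space X /\ hausdorff_space X.

Definition Cp (R : realType) (X : topologicalType) : Type := continuousType X R.

HB.instance Definition _ (R : realType) (X : topologicalType) :=
  Choice.on (Cp R X).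

HB.instance Definition _ (R : realType) (X : topologicalType) :=
  Topological.copy (Cp R X)
    (initial_topology (id : continuousType X R -> {ptws X -> R})).

Definition Ck (R : realType) (X : topologicalType) : Type := continuousType X R.

HB.instance Definition _ (R : realType) (X : topologicalType) :=
  Choice.on (Ck R X).

HB.instance Definition _ (R : realType) (X : topologicalType) :=
  Topological.copy (Ck R X)
    (initial_topology (id : continuousType X R -> {compact-open, X -> R})).

(* [set_type K] carries the topology induced from [Ck R Y]. *)
Definition evenly_continuous (R : realType) (Y : topologicalType)
    (K : set (Ck R Y)) : Prop :=
  continuous (fun p : Y * set_type K => (set_val p.2 : continuousType Y R) p.1).

Definition ascoli_space (R : realType) (Y : topologicalType) : Prop :=
  tychonoff_space Y /\
  forall K : set (Ck R Y), compact K -> evenly_continuous K.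

(* Main.v *)
Require Import Defs.
From mathcomp Require Import all_boot all_order all_algebra.
From mathcomp Require Import all_classical all_reals all_analysis.
From mathcomp Require Import lra.

(* If X is scattered, then whenever g lies in the closure of an open set W of
   C_p(X), some sequence in W converges to g; and on such a space a compact
   subset of C_k is equicontinuous at every point y, since a failure would
   already occur on a compact set {y} u {w_n} with w_n -> y, which a cluster
   point in C_k rules out.

   If X is not scattered, it contains a countable set e_0, e_1, ... without
   isolated points, and finite sets G_n of points of it which eventually meet
   every neighbourhood of every e_i but eventually avoid every given point.
   The functions F_n(g) = prod_{p in G_n} max(0, g(p) - g(e_0) - 1) eventually
   vanish on every compact subset of C_p(X), by Baire's argument in the complete
   space X, so {0} u {F_n} is compact in C_k(C_p(X)); but every neighbourhood
   of 0 in C_p(X) contains, for n large, some g with F_n(g) = 1. *)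

Set Implicit Arguments.
Unset Strict Implicit.
Unset Printing Implicit Defensive.

Import Order.TTheory GRing.Theory Num.Theory.
Import numFieldNormedType.Exports.

Local Open Scope classical_set_scope.
Local Open Scope ring_scope.

(** * Basic neighbourhoods for pointwise convergence *)

Lemma nbhs_initialP (S : choiceType) (T : topologicalType) (f : S -> T)
    (x : initial_topology f) (A : set S) :
  nbhs x A <-> exists2 B, nbhs (f x) B & f @^-1` B `<=` A.
Proof.
split=> [[_ [[B oB <-] Bx BA]]|[B Bx BA]]; first by exists B => //;
  exact: open_nbhs_nbhs.
by apply: filterS BA _; exact: initial_continuous.
Qed.

Lemma nbhs_ptwsP (R : realType) (T : topologicalType) (f : {ptws T -> R})
    (A : set {ptws T -> R}) :
  nbhs f A <-> exists s : seq T, exists2 e : R, 0 < e &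
    forall h : {ptws T -> R}, {in s, forall x, `|h x - f x| < e} -> A h.
Proof.
split=> [fA|[s [e e0 sA]]].
  (* The basic sets at [f] generate a filter converging pointwise to [f], which therefore contains
     every neighbourhood of [f]. *)
  pose F := filter_from [set p : seq T * R | 0 < p.2]
    (fun p => [set h : {ptws T -> R} | {in p.1, forall x, `|h x - f x| < p.2}]).
  have FF : Filter F.
    apply: filter_from_filter; first by exists ([::], 1) => /=.
    move=> [s e] [t r] /= e0 r0; exists (s ++ t, Num.min e r) => /=.
      by rewrite lt_min e0.
    move=> h hst; split=> x xs; (have := hst x; rewrite mem_cat xs ?orbT => /(_ isT));
      by rewrite lt_min => /andP[].
  have Ff : {ptws, F --> f}.
    apply/pointwise_cvgP => x; apply/cvgrPdist_lt => e e0.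
    exists ([:: x], e) => //= h /(_ x); rewrite inE eqxx distrC; exact.
  have [[s e] /= e0 sA] := Ff _ fA.
  by exists s, e.
apply: filterS sA _; elim: s => [|x s IHs]; first exact: filterE.
have fxe : nbhs (f x) (ball (f x) e) by exact: nbhsx_ballx.
have := @proj_continuous T (fun=> R) x f _ fxe.
apply: filterS2 IHs => h hs hx y; rewrite inE => /predU1P[->|]; last exact: hs.
by move: hx; rewrite /ball /= distrC.
Qed.

Section Cp_topology.
Context (R : realType) (X : topologicalType).
Implicit Types (g h : Cp R X) (x : X).

Lemma nbhs_CpP g (A : set (Cp R X)) :
  nbhs g A <-> exists s : seq X, exists2 e : R, 0 < e &
    forall h, {in s, forall x, `|h x - g x| < e} -> A h.
Proof.
split=> [/nbhs_initialP[B /nbhs_ptwsP[s [e e0 sB]] BA]|[s [e e0 sA]]].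
  by exists s, e => // h hs; apply: BA; exact: sB.
apply/nbhs_initialP.
exists [set h : {ptws X -> R} | {in s, forall x, `|h x - g x| < e}] => //.
by apply/nbhs_ptwsP; exists s, e.
Qed.

Lemma Cp_eval_continuous x : continuous (fun g : Cp R X => g x).
Proof.
move=> g B /nbhs_ballP[e e0 eB]; apply/nbhs_CpP; exists [:: x], e => // h.
by move=> /(_ x); rewrite inE eqxx distrC => /(_ isT); exact: eB.
Qed.

Lemma Cp_tychonoff : tychonoff_space (Cp R X).
Proof.
split.
  exact: (@uniform_completely_regular R
    (initial_topology (id : continuousType X R -> {ptws X -> R}))).
move=> g h gh; apply/continuousEP => x; apply: contrapT => /eqP gNh.
have e0 : 0 < `|g x - h x| / 2 by rewrite divr_gt0// normr_gt0 subr_eq0.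
have nb (k : Cp R X) : nbhs k [set f : Cp R X | `|f x - k x| < `|g x - h x| / 2].
  by apply/nbhs_CpP; exists [:: x], (`|g x - h x| / 2) => // f /(_ x);
    rewrite inE eqxx; exact.
have [f [/= fg fh]] := gh _ _ (nb g) (nb h).
have := ler_distD (f x) (g x) (h x); rewrite (distrC (g x) (f x)); lra.
Qed.

End Cp_topology.

(** * Convergent sequences and the compact-open topology *)

Lemma compact_cvg_seq (Y : topologicalType) (w : nat -> Y) (y : Y) (P : set nat) :
  w @ \oo --> y -> compact (y |` (w @` P)).
Proof.
move=> wy F PF FC; have [yF|] := pselect (cluster F y); first by exists y;
  split => //; left.
move=> /existsNP[A] /existsNP[B] /not_implyP[FA] /not_implyP[yB AB];
  have [N _ NB] := wy _ yB.
(* Some [A] in [F] misses a neighbourhood [B] of [y], so [F] lives on the finitely many terms of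
   index below [N]. *)
have cN : compact (w @` (P `&` `I_N)).
  by apply/finite_compact/finite_image; apply: sub_finite_set (finite_II N) => n [].
have [|_ [[n [Pn _] <-] nF]] := cN F PF.
  apply: filterS2 FA FC => z Az [zy|[n Pn nz]]; last first.
    exists n => //; split => //=; rewrite ltnNge; apply/negP => Nn.
    by apply: AB; exists z; split => //; rewrite -nz; exact: NB.
  exfalso; apply: AB; exists z; split => //; rewrite zy.
  exact: nbhs_singleton.
by exists (w n); split => //; right; exists n.
Qed.

Section Ck_topology.
Context (R : realType) (Y : topologicalType).

Lemma nbhs_Ck (f : Ck R Y) (C : set Y) (O : set R) :
    compact C -> open O -> (forall y, C y -> O (f y)) ->
  nbhs f [set g : Ck R Y | forall y, C y -> O (g y)].
Proof.
move=> cC oO fO; apply/nbhs_initialP.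
exists [set g : {compact-open, Y -> R} | g @` C `<=` O].
  apply: open_nbhs_nbhs; split; first exact: compact_open_open.
  by move=> _ [y Cy <-]; exact: fO.
by move=> g gO y Cy; apply: gO; exists y.
Qed.

Lemma Ck_cvg_eventually_eq (u : nat -> Ck R Y) (f : Ck R Y) :
    (forall C, compact C ->
      \forall n \near \oo, forall y, C y -> u n y = f y) ->
  u @ \oo --> f.
Proof.
move=> uf A /nbhs_initialP[B fB BA].
have cv : (fun n => (u n : {compact-open, Y -> R})) @ \oo --> (f :
  {compact-open, Y -> R}).
  apply/compact_open_cvgP => C O cC oO fO.
  apply: filterS (uf C cC) => n nf _ [y Cy <-]; rewrite nf//.
  by apply: fO; exists y.
by have [N _ NB] := cv _ fB; exists N => // n /NB; exact: BA.
Qed.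

End Ck_topology.

(** * A sequential criterion for the Ascoli property *)

Lemma ascoli_space_closure_open_seq (R : realType) (Y : topologicalType) :
    tychonoff_space Y ->
    (forall (W : set Y) (y : Y), open W -> closure W y ->
      exists2 w : nat -> Y, forall n, W (w n) & w @ \oo --> y) ->
  ascoli_space R Y.
Proof.
move=> tY sY; split => // K cK [y k] A /= /nbhs_ballP[e /= e0 eA].
have e2 : 0 < e / 2 by rewrite divr_gt0.
have e4 : 0 < e / 2 / 2 by rewrite divr_gt0.
(* Equicontinuity of [K] at [y] fails, at the scale [e / 2], exactly when [y] is in the closure of
   [W]. *)
pose W := \bigcup_(f in K) [set x | e / 2 < `|(f : Ck R Y) x - f y| ].
have oW : open W.
  apply: bigcup_open => f _.
  apply: (@open_comp _ _ (fun x => `|f x - f y|) [set t | e / 2 < t]);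
    last exact: open_gt.
  move=> x _; apply: cvg_norm; apply: cvgB; last exact: cvg_cst.
  exact: (@cts_fun _ _ (f : continuousType Y R)).
have : ~ closure W y.
  move=> /(sY _ _ oW)[w wW wy];
    have wP n : exists g : Ck R Y, K g /\ e / 2 < `|g (w n) - g y|.
    by have [g] := wW n; exists g.
  have [f fP] := choice wP.
  have [|h [Kh hF]] := cK (f @ \oo) _.
    by exists 0%N => // n _; have [] := fP n.
  have [N _ Nh] := wy _ (@cts_fun _ _ (h : continuousType Y R) y _
    (nbhsx_ballx (h y) (e / 2 / 2) e4)).
  (* On this compact tail [h] stays within [e / 4] of [h y]. Some [f n] with [n] at least [N] does
     too, so [f n (w n)] and [f n y] differ by less than [e / 2]. *)
  pose C := y |` (w @` [set n | (N <= n)%N]).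
  have hC : forall x, C x -> ball (h y) (e / 2 / 2) (h x).
    by move=> x [->|[n /= Nn <-]]; [exact: ballxx|exact: Nh].
  have [|_ [[n Nn <-] fn]] := hF (f @` [set n | (N <= n)%N]) _ _
      (nbhs_Ck (@compact_cvg_seq _ _ _ _ wy) (@ball_open _ _ (h y) (e / 2 / 2)) hC).
    by exists N => // n Nn; exists n.
  have Bn : ball (h y) (e / 2 / 2) (f n (w n)) by apply: fn; right; exists n.
  have By : ball (h y) (e / 2 / 2) (f n y) by apply: fn; left.
  have [_ /=] := fP n; apply/negP; rewrite -leNgt.
  move: Bn By; rewrite /ball /= => Bn By.
  have := ler_distD (h y) (f n (w n)) (f n y); rewrite (distrC (f n (w n)) (h y)).
  have {}Bn : `|h y - f n (w n)| < e / 2 / 2 by [].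
  have {}By : `|h y - f n y| < e / 2 / 2 by [].
  lra.
move=> /existsNP[U /not_implyP[Uy UW]].
have kU : nbhs k [set k' : set_type K | ball (set_val k y) (e / 2) ((set_val k' :
  Ck R Y) y)].
  apply/nbhs_initialP; exists [set g :
    Ck R Y | forall x, [set y] x -> ball (set_val k y) (e / 2) (g x)].
    apply: nbhs_Ck; first exact: compact_set1.
      exact: ball_open.
    by move=> x ->; exact: ballxx.
  by move=> k' /(_ y erefl).
exists (U, [set k' : set_type K | ball (set_val k y) (e / 2) ((set_val k' :
  Ck R Y) y)]) => //.
move=> [x k'] [/= Ux kk']; apply: eA; rewrite /ball /=.
have xk' : `|(set_val k' : Ck R Y) x - (set_val k' : Ck R Y) y| <= e / 2.
  rewrite leNgt; apply/negP => xk'; apply: UW; exists x; split => //.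
  by exists (set_val k') => //; exact: set_valP.
have {}kk' : `|(set_val k : Ck R Y) y - (set_val k' : Ck R Y) y| < e / 2 by [].
have := ler_distD ((set_val k' : Ck R Y) y) ((set_val k : Ck R Y) y) ((set_val k' :
  Ck R Y) x).
rewrite (distrC ((set_val k' : Ck R Y) y) ((set_val k' : Ck R Y) x)).
lra.
Qed.

Lemma eventually_natSinv_lt (R : realType) (e : R) :
  0 < e -> exists N, forall n, (N <= n)%N -> n.+1%:R^-1 < e.
Proof.
move=> e0; have [N _ NP] := near_infty_natSinv_lt (PosNum e0).
by exists N => n; exact: NP.
Qed.

(** * Metric spaces and the scattered case *)

Section metric.
Context (R : realType) (X : topologicalType) (d : X -> X -> R).
Hypotheses (dm : is_metric d) (dt : induces_topology d).

Let d_eq0 x y : d x y = 0 <-> x = y. Proof. by case: dm. Qed.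
Let dC x y : d x y = d y x. Proof. by case: dm. Qed.
Let dD x y z : d x z <= d x y + d y z. Proof. by case: dm. Qed.

Lemma metric_refl x : d x x = 0. Proof. exact/d_eq0. Qed.

Lemma metric_ge0 x y : 0 <= d x y.
Proof. have := dD x y x; rewrite metric_refl (dC y x); lra. Qed.

Lemma metric_gt0 x y : x != y -> 0 < d x y.
Proof.
by move=> xy; rewrite lt0r metric_ge0 andbT; apply: contra_neq xy => /d_eq0.
Qed.

Lemma nbhs_metric_ball x r : 0 < r -> nbhs x [set y | d x y < r].
Proof. by move=> r0; apply/dt; exists r. Qed.

Lemma metric_continuous p : continuous (d p).
Proof.
move=> x A /nbhs_ballP[e e0 eA]; apply/dt; exists e => // y /= xy; apply: eA.
rewrite /ball /= ltr_norml; have := dD p x y; have := dD p y x; rewrite (dC y x).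
by move=> ? ?; apply/andP; split; lra.
Qed.

(* [V] is the union of all countable basic open pieces of [closure D]; an
   isolated point of [closure D `\` V] would itself lie in such a piece. *)
Lemma countable_closure_scattered (D : set X) :
  scattered X -> countable D -> countable (closure D).
Proof.
move=> sX cD; pose B (p : X * nat) := [set y | d p.1 y < p.2.+1%:R^-1] `&` closure D.
pose I := [set p | D p.1 /\ countable (B p)]; pose V := \bigcup_(p in I) B p.
have cV : countable V.
  apply: bigcup_countable => [|p []//].
  apply: (@sub_countable _ _ _ (D `*` setT)); last exact: countableX.
  by apply: subset_card_le => p [].
suff DV : closure D `<=` V by apply: sub_countable cV; exact: subset_card_le.
apply: contrapT => /existsNP[z /not_implyP[Dz Vz]].
have [x [/set_mem[/= Dx Vx] [U Ux UA]]] :=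
  sX (closure D `\` V) (ex_intro _ z (conj Dz Vz)).
have /dt[e e0 eU] := Ux.
have [|m /(_ m (leqnn m)) me] := @eventually_natSinv_lt R (e / 2).
  by rewrite divr_gt0.
have [|a [Da /= xa]] := Dx _ (@nbhs_metric_ball x m.+1%:R^-1 _); first by [].
apply: Vx; exists (a, m); last by split => //=; rewrite dC.
(* Within [e] of [x], every point of [closure D] other than [x] lies in [V]; the piece indexed by
   [(a, m)] has diameter below [e], so it is countable. *)
split => //; pose W (b : bool) := if b then [set x] else V.
apply: (@sub_countable _ _ _ (\bigcup_(b in setT) W b)); last first.
  by apply: bigcup_countable => // -[] _ //; exact: countable1.
apply: subset_card_le => y [/= ay Dy].
have [Vy|Vy] := pselect (V y); first by exists false.
exists true => //=; suff: (U `&` (closure D `\` V)) y by rewrite UA.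
split=> //; apply: eU => /=; have := dD x a y.
by move: xa ay me; move: (m.+1%:R^-1) => r *; lra.
Qed.

Lemma nbhs_notin (s : seq X) x : x \notin s -> nbhs x [set y | y \notin s].
Proof.
elim: s => [_|a s IHs]; first exact: filterE.
rewrite inE negb_or => /andP[/metric_gt0 xa /IHs].
apply: filterS2 (nbhs_metric_ball x xa) => y /= ya ys.
by rewrite inE negb_or ys andbT; apply: contraTneq ya => ->; rewrite ltxx.
Qed.

Lemma finite_bump (s : seq X) (U : set X) : {in s, forall p, nbhs p U} ->
  exists f : X -> R, [/\ continuous f, {in s, forall p, f p = 1} &
    forall x, ~ U x -> f x = 0].
Proof.
elim: s => [_|p s IHs sU].
  by exists (cst 0); split => // x; exact: cst_continuous.
have [q qs|f [fc f1 f0]] := IHs; first by apply: sU; rewrite inE qs orbT.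
have /dt[e e0 eU] : nbhs p U by apply: sU; rewrite mem_head.
pose g x := Num.max (1 - e^-1 * d p x) 0.
have gc : continuous g.
  move=> x; apply: (@continuous_max R X (fun x => 1 - e^-1 * d p x) (cst 0)).
    apply: continuousB; first exact: cst_continuous.
    by apply: continuousM; [exact: cst_continuous|exact: metric_continuous].
  exact: cst_continuous.
(* This combination is 1 where [f] or the tent [g] is 1, and 0 where both vanish. *)
exists (fun x => 1 - (1 - f x) * (1 - g x)); split.
- move=> x; apply: cvgB; first exact: cvg_cst.
  apply: cvgM; (apply: cvgB; first exact: cvg_cst); [exact: fc|exact: gc].
- move=> x; rewrite inE => /predU1P[->|/f1 ->]; last by rewrite subrr mul0r subr0.
  by rewrite /g metric_refl mulr0 subr0 max_l// subrr mulr0 subr0.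
move=> x Ux; rewrite f0// /g max_r ?subr0 ?mul1r ?subrr// subr_le0.
rewrite -(mulVf (lt0r_neq0 e0)) ler_pM2l ?invr_gt0// leNgt.
by apply/negP => /eU.
Qed.

(** Truncating [b - a] to the interval from [-e] to [e] keeps [c] near [a] everywhere and changes
    nothing where [b] is already close. *)
Lemma clamp_approx (a b : X -> R) (e : R) : 0 < e -> continuous a -> continuous b ->
  exists c : X -> R, [/\ continuous c, forall x, `|c x - a x| <= e &
    forall x, `|b x - a x| < e -> c x = b x].
Proof.
move=> e0 ac bc; exists (fun x => a x + Num.max (- e) (Num.min e (b x - a x))); split.
- move=> x; apply: cvgD; first exact: ac.
  apply: (@continuous_max R X (cst (- e)) (fun x => Num.min e (b x - a x))).
    exact: cst_continuous.
  apply: (@continuous_min R X (cst e) (fun x => b x - a x)).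
    exact: cst_continuous.
  apply: cvgB; [exact: bc|exact: ac].
- move=> x; rewrite addrAC subrr add0r ler_norml le_max lexx /=.
  by rewrite ge_max ge_min lexx andbT; lra.
move=> x; rewrite ltr_norml => /andP[h1 h2].
by rewrite min_r ?ltW// max_r ?ltW// addrC subrK.
Qed.

(* [Cp R X] is a kappa-Frechet-Urysohn space: choosing elements of [W] closer
   and closer to [g] on growing finite sets [E n], one corrects them
   far from [g] only inside neighbourhoods of the sets [F n \ E n], and these
   can be chosen point-finite along a subsequence because the closure of
   the union of the [E n] is countable. *)
Lemma Cp_closure_open_seq (W : set (Cp R X)) (g : Cp R X) :
    scattered X -> open W -> closure W g ->
  exists2 w : nat -> Cp R X, forall n, W (w n) & w @ \oo --> g.
Proof.
move=> sX oW Wg.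
(* From a finite set and a tolerance index comes a member of [W], with a finite set on which
   agreement with it forces membership in [W]. *)
have step (q : seq X * nat) : exists p : Cp R X * seq X,
    {in q.1, forall x, `|p.1 x - g x| < q.2.+1%:R^-1} /\
    forall h : Cp R X, {in p.2, h =1 p.1} -> W h.
  have [|h [Wh hg]] := Wg [set h :
    Cp R X | {in q.1, forall x, `|h x - g x| < q.2.+1%:R^-1}].
    by apply/nbhs_CpP; exists q.1, q.2.+1%:R^-1 => //; rewrite invr_gt0.
  have /nbhs_CpP[s [e e0 sW]] : nbhs h W by exact: open_nbhs_nbhs.
  exists (h, s); split => // h' hs; apply: sW => x /hs ->.
  by rewrite subrr normr0.
have [st stP] := choice step.
pose E := fix E n := if n is m.+1 then E m ++ (st (E m, m)).2 else [::].
pose h n := (st (E n, n)).1; pose F n := (st (E n, n)).2.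
have hE n : {in E n, forall x, `|h n x - g x| < n.+1%:R^-1} by case: (stP (E n, n)).
have hF n (h' : Cp R X) : {in F n, h' =1 h n} -> W h' by case: (stP (E n, n)) => _;
  exact.
have Esub m n : (m <= n)%N -> {subset E m <= E n}.
  elim: n => [|n IHn]; first by rewrite leqn0 => /eqP->.
  rewrite leq_eqVlt => /predU1P[->//|/IHn mn] x /mn xn.
  by rewrite /= mem_cat xn.
pose D := \bigcup_n [set` E n].
have cD : countable D.
  by apply: bigcup_countable => // n _; exact: finite_set_countable.
have /countable_injP[f finj] := countable_closure_scattered sX cD.
have stage (s : seq X) : exists M, {in s, forall x, D x -> x \in E M}.
  elim: s => [|x s [M HM]]; first by exists 0%N.
  have [[m _ /= xm]|Dx] := pselect (D x); last first.
    by exists M => y; rewrite inE => /predU1P[->//|]; exact: HM.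
  exists (maxn m M) => y; rewrite inE => /predU1P[-> _|ys Dy].
    by apply: Esub xm; exact: leq_maxl.
  by apply: (Esub M); [exact: leq_maxr|exact: HM].
(* The two cases are the points of [closure D] with code at most [k] and the points far from [D].
   Every point falls under one of them for large [k]. *)
have wP k : exists w : Cp R X, W w /\ forall x,
    (closure D x /\ (f x <= k)%N) \/ (forall y, D y -> k.+1%:R^-1 <= d y x) ->
    `|w x - g x| <= k.+1%:R^-1.
  have [L LE] : exists L : seq X, [set x | closure D x /\ (f x <= k)%N] = [set` L].
    apply/finite_seqP.
    set A := [set x | _]; have fA : {in A &, injective f}.
      by move=> x y /set_mem[xD _] /set_mem[yD _]; apply: finj; exact/mem_set.
    rewrite -(eq_finite_set (inj_card_eq fA)); apply: sub_finite_set (finite_II k.+1).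
    by move=> _ [x [_ xk] <-].
  (* [E M] contains all points of [L] in [D], so the points [G] still to be corrected avoid [L], and
     the bump can vanish on [L]. *)
  have [M ML] := stage L; pose n := maxn k M.
  pose G := [seq x <- F n | x \notin E n].
  have GD x : x \in G -> D x.
    rewrite mem_filter => /andP[_ xF]; exists n.+1 => //=.
    by rewrite mem_cat xF orbT.
  have [p pG|phi [phic phi1 phi0]] := @finite_bump G
      ([set y | y \notin L] `&` [set y | exists2 p, p \in G & d p y < k.+1%:R^-1]).
    apply: filterI.
      apply: nbhs_notin; apply/negP => pL.
      have : p \in E n by apply: (Esub M); [exact: leq_maxr|apply: ML => //; exact: GD].
      by move: pG; rewrite mem_filter => /andP[/negP].
    apply: filterS (@nbhs_metric_ball p k.+1%:R^-1 _) => [y /= py|]; first by exists p.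
    by rewrite invr_gt0.
  have n0 : 0 < n.+1%:R^-1 :> R by rewrite invr_gt0.
  have [c [cc cg ch]] := clamp_approx n0 (@cts_fun _ _ g) (@cts_fun _ _ (h n)).
  (* [phi] switches from [c], near [g], to [h n] on [G]. On [E n] the two agree already, so the
     result equals [h n] on [F n] and lies in [W]. *)
  have wc : continuous (fun x => c x + phi x * (h n x - c x)).
    move=> x; apply: cvgD; first exact: cc.
    by apply: cvgM; [exact: phic|apply: cvgB; [exact: cts_fun|exact: cc]].
  exists (mkcts wc : continuousType X R); split.
    apply: (hF n) => x xF; rewrite /= /mkcts.
    have [xE|xE] := boolP (x \in E n); first by rewrite ch ?subrr ?mulr0 ?addr0//;
      exact: hE.
    by rewrite phi1 ?mem_filter ?xE// mul1r addrC subrK.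
  move=> x xk; rewrite /= /mkcts phi0 ?mul0r ?addr0; last first.
    case: xk => [xk|xD] [/= xL [p pG]]; last by rewrite ltNge xD//; exact: GD.
    have : [set` L] x by rewrite -LE.
    by rewrite /= (negPf xL).
  apply: le_trans (cg x) _; rewrite lef_pV2 ?posrE//.
  by rewrite ler_nat ltnS leq_maxl.
have [w wW] := choice wP.
exists w => [n|A /nbhs_CpP[s [e e0 sA]]]; first by case: (wW n).
suff : \forall n \near \oo, {in s, forall x, `|w n x - g x| < e}.
  by apply: filterS => n; exact: sA.
have [N NP] := eventually_natSinv_lt e0.
elim: s {sA} => [|x s IHs]; first exact: filterE.
have [M MP] : exists M, forall n, (M <= n)%N ->
    (closure D x /\ (f x <= n)%N) \/ (forall y, D y -> n.+1%:R^-1 <= d y x).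
  have [Dx|] := pselect (closure D x); first by exists (f x) => n; left.
  move=> /existsNP[U /not_implyP[/dt[r r0 rU] UD]].
  have [M MP] := eventually_natSinv_lt r0.
  exists M => n /MP nr; right => y Dy; rewrite leNgt; apply/negP => yx.
  by apply: UD; exists y; split => //; apply: rU => /=; rewrite dC; exact: lt_trans nr.
apply: filterS2 IHs (nbhs_infty_ge (maxn N M)) => n ns /=;
  rewrite geq_max => /andP[Nn Mn].
move=> y; rewrite inE => /predU1P[->|]; last exact: ns.
have [_ /(_ x (MP _ Mn)) wg] := wW n.
by apply: le_lt_trans wg _; exact: NP.
Qed.

End metric.

(** * The case of a non-scattered space *)

Section not_scattered.
Context (R : realType) (X : topologicalType) (d : X -> X -> R).
Hypotheses (dm : is_metric d) (dt : induces_topology d).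

Let dD x y z : d x z <= d x y + d y z. Proof. by case: dm. Qed.

(** If [A] has no isolated point, each [a] in [A] has other points [c (a, k)] of [A] arbitrarily
    close to it. Closing one point under these moves gives a countable set. *)
Lemma dense_in_itself_seq : ~ scattered X ->
  exists e : nat -> X, forall i U, nbhs (e i) U -> exists2 j, U (e j) & e j != e i.
Proof.
move=> /existsNP[A /not_implyP[[a0 Aa0] A0]].
have cP (p : X * nat) : exists b, A p.1 ->
    [/\ A b, b != p.1 & d p.1 b < p.2.+1%:R^-1].
  case: p => a k /=; have [Aa|] := pselect (A a); last by exists a.
  apply: contrapT => /forallNP nb; apply: A0; exists a; split; first exact/mem_set.
  exists [set b | d a b < k.+1%:R^-1].
    by apply: (nbhs_metric_ball dt); rewrite invr_gt0.
  apply/seteqP; split => [b [/= ab Ab]|_ ->]; last first.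
    by split => //=; rewrite (metric_refl dm) invr_gt0.
  by apply: contrapT => /eqP ba; apply: (nb b).
have [c {}cP] := choice cP.
pose ev (s : seq nat) := foldr (fun k a => c (a, k)) a0 s.
have Aev s : A (ev s) by elim: s => //= k s /(cP (ev s, k))[].
(* Numbers that decode to nothing give the empty word, that is [a0]; repetitions in the enumeration
   are harmless. *)
exists (fun i => ev (odflt [::] (unpickle i))) => i U.
move: (odflt _ _) => s /dt[r r0 rU].
have [N /(_ N (leqnn N)) Nr] := eventually_natSinv_lt r0.
exists (pickle (N :: s)); rewrite pickleK /=;
  have [_ ? dN] := cP (ev s, N) (Aev s) => //.
by apply: rU => /=; exact: lt_trans Nr.
Qed.

Section dense_in_itself.
Variable e : nat -> X.
Hypothesis e_dense : forall i U, nbhs (e i) U -> exists2 j, U (e j) & e j != e i.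

Lemma dense_in_itself_notin i U (s : seq X) : nbhs (e i) U ->
  exists2 j, U (e j) & e j \notin s.
Proof.
move=> iU; have := nbhs_notin dm dt (s := [seq x <- s | x != e i]) (x := e i).
rewrite mem_filter eqxx => /(_ isT) nes.
have [j [Uj js] ji] := e_dense (filterI iU nes).
by exists j => //; move: js; rewrite /= mem_filter ji.
Qed.

(** For each [i] up to [n], put into [G n] a point within [1/(n+1)] of [e i] and distinct from
    [e 0], ..., [e n]. A given point is off the range of [e], or is excluded once [n] reaches its
    index. *)
Lemma dense_in_itself_finite_sets : exists G : nat -> seq X,
  (forall i U, nbhs (e i) U -> exists N, forall n, (N <= n)%N ->
     exists2 j, U (e j) & e j \in G n) /\
  (forall s : seq X, exists N, forall n, (N <= n)%N -> {in s, forall x, x \notin G n}).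
Proof.
have pP (q : nat * nat) : exists j, d (e q.2) (e j) < q.1.+1%:R^-1 /\
    e j \notin [seq e i | i <- iota 0 q.1.+1].
  have [|j] := @dense_in_itself_notin q.2 [set y | d (e q.2) y < q.1.+1%:R^-1]
      [seq e i | i <- iota 0 q.1.+1].
    by apply: (nbhs_metric_ball dt); rewrite invr_gt0.
  by exists j.
have [p {}pP] := choice pP.
exists (fun n => [seq e (p (n, i)) | i <- iota 0 n.+1]); split.
  move=> i U /dt[r r0 rU]; have [N Nr] := eventually_natSinv_lt r0.
  exists (maxn i N) => n; rewrite geq_max => /andP[ni nN].
  exists (p (n, i)); last by apply: map_f; rewrite mem_iota.
  by apply: rU => /=; apply: lt_trans (Nr n nN); have [] := pP (n, i).
elim=> [|x s [N HN]]; first by exists 0%N.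
have [[j _ jx]|xe] := pselect (range e x); last first.
  exists N => n /HN ns y; rewrite inE => /predU1P[->|/ns//].
  by apply/mapP => -[i _ xi]; apply: xe; exists (p (n, i)).
exists (maxn j N) => n; rewrite geq_max => /andP[jn /HN ns] y.
rewrite inE => /predU1P[->|/ns//]; apply/mapP => -[i _ xi].
have [_] := pP (n, i); rewrite -xi -jx map_f//.
by rewrite mem_iota.
Qed.

(** Only a cluster point is extracted: a compact subset of [Cp R X] need not be sequentially
    compact. *)
Lemma Cp_compact_cluster_seq (L : set (Cp R X)) (u : nat -> Cp R X) :
    compact L -> (forall n, L (u n)) ->
  exists g : Cp R X, forall (s : seq X) (r : R) N, 0 < r ->
    exists2 n, (N <= n)%N & {in s, forall x, `|u n x - g x| < r}.
Proof.
move=> cL Lu; have [|g [_ ug]] := cL (u @ \oo) _; first by exists 0%N => // n _;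
  exact: Lu.
exists g => s r N r0.
have gs : nbhs (g : Cp R X) [set h : Cp R X | {in s, forall x, `|h x - g x| < r}].
  by apply/nbhs_CpP; exists s, r.
have [|_ [[n Nn <-] us]] := ug (u @` [set n | (N <= n)%N]) _ _ gs; last by exists n.
by exists N => // n Nn; exists n.
Qed.

Hypothesis d_complete : forall u : nat -> X, cauchy_seq d u -> exists l :
  X, u @ \oo --> l.

Section vanishing.
Variable G : nat -> seq X.
Hypothesis G_dense : forall i U, nbhs (e i) U -> exists N, forall n, (N <= n)%N ->
  exists2 j, U (e j) & e j \in G n.

(* If this fails along a sequence [u] in [L], nested balls give a limit [x] of
   points of the range of [e], close to [e 0], at which infinitely many [u n]
   exceed [u n (e 0)] by more than 1. That subsequence is also chosen to
   converge on the range of [e], so its cluster points agree at [x] with a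
   cluster point [g] of [u]; but [g x < g (e 0) + 1] since [x] is close to
   [e 0]. *)
Lemma compact_eventually_not_above (L : set (Cp R X)) : compact L ->
  exists N, forall n g, (N <= n)%N -> L g ->
    exists2 p, p \in G n & g p <= g (e 0%N) + 1.
Proof.
move=> cL; apply: contrapT => /forallNP noN.
have vP N : exists w : nat * Cp R X, [/\ (N <= w.1)%N, L w.2 &
    {in G w.1, forall p, w.2 (e 0%N) + 1 < w.2 p}].
  have /existsNP[n /existsNP[g /not_implyP[Nn /not_implyP[Lg ng]]]] := noN N.
  exists (n, g); split => // p pG; rewrite ltNge; apply/negP => gp.
  by apply: ng; exists p.
have [v {}vP] := choice vP.
pose u n := (v n).2.
have Lu n : L (u n) by case: (vP n).
have [g ug] := Cp_compact_cluster_seq cL Lu.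
(* A state [(i, r, l)] is a closed ball about [e i] of radius [r], with a bound [l]. The step
   returns the next state and an index [k] such that [u k] is near [g] on [e 0], ..., [e l]. *)
have stepP (q : nat * R * nat) : exists q' : nat * R * nat * nat, 0 < q.1.2 ->
    [/\ 0 < q'.1.1.2 /\ q'.1.1.2 <= q.2.+1%:R^-1, (q.2 <= q'.2)%N, q'.1.2 = q'.2.+1,
      forall j, (j <= q.2)%N -> `|u q'.2 (e j) - g (e j)| < q.2.+1%:R^-1 &
      forall y, d (e q'.1.1.1) y <= q'.1.1.2 ->
        d (e q.1.1) y <= q.1.2 /\ u q'.2 (e 0%N) + 1 < u q'.2 y].
  case: q => [[i r] l] /=; have [r0|] := ltP 0 r; last by exists (0%N, 0, 0%N, 0%N).
  have l0 : 0 < l.+1%:R^-1 :> R by rewrite invr_gt0.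
  have [N NP] := G_dense (nbhs_metric_ball dt (e i) r0).
  have [k Nk kg] := ug [seq e j | j <- iota 0 l.+1] _ (maxn N l) l0.
  move: Nk; rewrite geq_max => /andP[Nk lk].
  have [vk _ uG] := vP k.
  have [j /= ij jG] := NP _ (leq_trans Nk vk).
  have : nbhs (e j) ([set y | d (e i) y < r] `&` [set y | u k (e 0%N) + 1 < u k y]).
    apply: filterI.
      have lr : nbhs (d (e i) (e j)) [set t | t < r] by apply: open_nbhs_nbhs;
        split => //; exact: open_lt.
      exact: (metric_continuous dm dt lr).
    have lr : nbhs (u k (e j)) [set t | u k (e 0%N) + 1 < t].
      by apply: open_nbhs_nbhs; split; [exact: open_gt|exact: uG].
    exact: (@cts_fun _ _ (u k) _ _ lr).
  (* Halving fits the new closed ball into the open one of radius [r']; the other bound drives the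
     radii to 0. *)
  move=> /dt[r' r'0 r'P]; exists (j, Num.min (r' / 2) l.+1%:R^-1, k.+1, k) => _ /=;
    split => //.
  - by rewrite lt_min ge_min lexx orbT l0 divr_gt0.
  - by move=> m ml; apply: kg; rewrite map_f// mem_iota.
  move=> y; rewrite le_min => /andP[jy _].
  have /r'P[/= /ltW iy uy] : d (e j) y < r' by apply: le_lt_trans jy _;
    rewrite ltr_pdivrMr// ltr_pMr// ltr1n.
  by split.
have [st {}stepP] := choice stepP.
have [r0 r00 r0P] : exists2 r :
  R, 0 < r & forall y, d (e 0%N) y <= r -> g y < g (e 0%N) + 1.
  have lr : nbhs (g (e 0%N)) [set t | t < g (e 0%N) + 1].
    by apply: open_nbhs_nbhs; split; [exact: open_lt|rewrite /= ltrDl].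
  have /dt[r r0 rP] := @cts_fun _ _ g _ _ lr.
  exists (r / 2); first by rewrite divr_gt0.
  by move=> y ry; apply: rP => /=; apply: le_lt_trans ry _;
    rewrite ltr_pdivrMr// ltr_pMr// ltr1n.
pose q := fix q n := if n is m.+1 then (st (q m)).1 else (0%N, r0, 0%N).
pose z n := e (q n).1.1; pose r n := (q n).1.2; pose l n := (q n).2.
pose k n := (st (q n)).2.
have rpos n : 0 < r n by elim: n => //= n /stepP[[]].
have rl n : r n.+1 <= (l n).+1%:R^-1 by case: (stepP _ (rpos n)) => -[].
have lk n : (l n <= k n)%N by case: (stepP _ (rpos n)).
have lS n : l n.+1 = (k n).+1 by case: (stepP _ (rpos n)).
have kg n j : (j <= l n)%N -> `|u (k n) (e j) - g (e j)| < (l n).+1%:R^-1.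
  by case: (stepP _ (rpos n)) => _ _ _ + _; exact.
have nest n y : d (z n.+1) y <= r n.+1 ->
  d (z n) y <= r n /\ u (k n) (e 0%N) + 1 < u (k n) y.
  by case: (stepP _ (rpos n)) => _ _ _ _; exact.
have ln n : (n <= l n)%N.
  by elim: n => // n IHn; rewrite lS ltnS (leq_trans IHn).
have nests m n y : (m <= n)%N -> d (z n) y <= r n -> d (z m) y <= r m.
  elim: n => [|n IHn]; first by rewrite leqn0 => /eqP->.
  rewrite leq_eqVlt => /predU1P[->//|mn] /nest[ny _]; exact: IHn.
have zz m n : (m <= n)%N -> d (z m) (z n) <= r m.
  by move=> mn; apply: (nests m n) => //; rewrite (metric_refl dm) ltW.
have rlim n : r n.+1 <= n.+1%:R^-1.
  by apply: le_trans (rl n) _; rewrite lef_pV2 ?posrE// ler_nat ltnS.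
have zc : cauchy_seq d z.
  move=> eps eps0; have [|N /(_ N (leqnn N)) NP] := @eventually_natSinv_lt R (eps / 2).
    by rewrite divr_gt0.
  exists N.+1 => m n Nm Nn; have := dD (z m) (z N.+1) (z n).
  have [_ dC _] := dm; rewrite (dC (z m) (z N.+1)).
  have := zz _ _ Nm; have := zz _ _ Nn; have := rlim N.
  move: NP; move: (N.+1%:R^-1) => t *; lra.
have [x zx] := d_complete zc.
have zxr m : d (z m) x <= r m.
  rewrite leNgt; apply/negP => mx.
  have lr : nbhs (d (z m) x) [set t | r m < t] by apply: open_nbhs_nbhs; split => //;
    exact: open_gt.
  have [N _ NP] := zx _ (metric_continuous dm dt lr).
  have /= := NP (maxn m N) (leq_maxr _ _); rewrite ltNge zz//.
  exact: leq_maxl.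
have ux n : u (k n) (e 0%N) + 1 < u (k n) x by case: (nest n x (zxr _)).
have [g' ug'] := Cp_compact_cluster_seq cL (fun n => Lu (k n)).
have gg' j : g' (e j) = g (e j).
  apply/eqP; rewrite -subr_eq0 -normr_le0; apply/ler_addgt0Pr => eps eps0;
    rewrite add0r.
  have [|N NP] := @eventually_natSinv_lt R (eps / 2); first by rewrite divr_gt0.
  have [|n] := ug' [:: e j] (eps / 2) (maxn j N); first by rewrite divr_gt0.
  rewrite geq_max => /andP[jn Nn] /(_ _ (mem_head _ _)) ng'.
  have ng := kg n j (leq_trans jn (ln n)).
  have nl := NP _ (leq_trans Nn (ln n)).
  have := ler_distD (u (k n) (e j)) (g' (e j)) (g (e j));
    rewrite (distrC (g' (e j)) (u _ _)).
  by move: nl ng; move: (_.+1%:R^-1) => t *; lra.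
have gx : g' x = g x.
  apply: (@cvg_unique _ (@Rhausdorff R) (g' \o z @ \oo)).
    exact: cvg_comp zx (@cts_fun _ _ g' x).
  have -> : g' \o z = g \o z by apply/funext => n; exact: gg'.
  exact: cvg_comp zx (@cts_fun _ _ g x).
have gx1 := r0P x (zxr 0%N).
(* Half the gap between [g x] and [g (e 0) + 1], spent at both [x] and [e 0], makes [u (k n) x] less
   than [u (k n) (e 0) + 1], against [ux]. *)
have [|n _ gn] := ug' [:: x; e 0%N] ((g (e 0%N) + 1 - g x) / 2) 0%N.
  by rewrite divr_gt0// subr_gt0.
have := gn x; rewrite mem_head => /(_ isT).
have := gn (e 0%N); rewrite !inE eqxx orbT => /(_ isT).
rewrite gx gg' !ltr_norml => /andP[? ?] /andP[? ?]; have := ux n; lra.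
Qed.

End vanishing.

End dense_in_itself.
End not_scattered.

(** * The two implications and the theorem *)

Lemma scattered_of_ascoli_Cp (R : realType) (X : topologicalType) :
  completely_metrizable R X -> ascoli_space R (Cp R X) -> scattered X.
Proof.
move=> [d [dm dt dc]] [_ aX]; apply: contrapT => nsX.
have [e e_dense] := dense_in_itself_seq dm dt nsX.
have [G [G_dense G_notin]] := dense_in_itself_finite_sets dm dt e_dense.
pose F0 n (g : Cp R X) := \prod_(p <- G n) Num.max 0 (g p - g (e 0%N) - 1).
have excess_c (T : topologicalType) (a b : T -> R) : continuous a -> continuous b ->
    continuous (fun t => Num.max 0 (a t - b t - 1)).
  move=> ac bc t; apply: (@continuous_max R T (cst 0)); first exact: cst_continuous.
  apply: cvgB; last exact: cvg_cst.
  apply: cvgB; [exact: ac|exact: bc].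
have F0c n : continuous (F0 n).
  apply: (@continuous_big R X *%R 1 xpredT); first exact: mul_continuous.
  by move=> p _; apply: excess_c; exact: Cp_eval_continuous.
pose F n : Ck R (Cp R X) := (mkcts (F0c n) : continuousType (Cp R X) R).
have zc (T : topologicalType) : continuous (fun _ : T => 0 :
  R) by exact: cst_continuous.
pose Z : Ck R (Cp R X) := (mkcts (@zc (Cp R X)) : continuousType (Cp R X) R).
pose z : Cp R X := (mkcts (@zc X) : continuousType X R).
have FZ : F @ \oo --> Z.
  apply: Ck_cvg_eventually_eq => L cL.
  have [N NP] := compact_eventually_not_above dm dt dc G_dense cL.
  exists N => // n /= Nn g Lg; have [p pG gp] := NP _ _ Nn Lg.
  rewrite /= /mkcts /F0 (big_rem p)//= max_l ?mul0r// subr_le0 lerBlDr addrC.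
  by rewrite (le_trans gp) // addrC.
pose K := Z |` (F @` setT).
have cK : compact K by exact: compact_cvg_seq.
have KZ : Z \in K by apply/mem_set; left.
have KF n : F n \in K by apply/mem_set; right; exists n.
have [[U V] /= [zU ZV] UV] := aX K cK (z, SigSub KZ) _ (nbhsx_ballx _ 1 ltr01).
have /nbhs_CpP[s [r r0 sU]] := zU.
have /nbhs_initialP[B ZB BV] := ZV.
have [N1 _ N1P] := FZ _ ZB.
(* Avoiding [e 0] as well as [s] lets the bump vanish there, so that [h] lies in [U] and is 0 at
   [e 0]. *)
have [N2 N2P] := G_notin (e 0%N :: s).
pose n := maxn N1 N2.
have Gs := N2P n (leq_maxr _ _).
have [p pG|b [bc b1 b0]] :=
  @finite_bump _ _ _ dm dt (G n) [set y | y \notin e 0%N :: s].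
  by apply: (nbhs_notin dm dt); apply: contraL pG => /Gs.
(* The 2 makes each factor of [F0 n h] equal to [2 - 0 - 1 = 1]. *)
have hc : continuous (fun x => 2 * b x).
  by move=> x; apply: cvgM; [exact: cvg_cst|exact: bc].
pose h : Cp R X := (mkcts hc : continuousType X R).
have hs x : x \in e 0%N :: s -> h x = 0.
  by move=> xs; rewrite /= /mkcts b0 ?mulr0// => /=; rewrite xs.
have hUV : (U `*` V) (h, SigSub (KF n)).
  split => /=; first by apply: sU => x xs; rewrite hs ?inE ?xs ?orbT// subrr normr0.
  by apply: BV; apply: N1P; exact: leq_maxl.
have F0h : F0 n h = 1.
  rewrite /F0 big_seq big1// => p pG; rewrite (hs (e 0%N)) ?mem_head//.
  by rewrite /= /mkcts b1// mulr1 subr0 max_r; lra.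
have : ball (0 : R) 1 (F0 n h) := UV _ hUV.
by rewrite F0h /ball /= sub0r normrN normr1 ltxx.
Qed.

Lemma ascoli_Cp_of_scattered (R : realType) (X : topologicalType) :
  completely_metrizable R X -> scattered X -> ascoli_space R (Cp R X).
Proof.
move=> [d [dm dt _]] sX; apply: ascoli_space_closure_open_seq;
  first exact: Cp_tychonoff.
by move=> W g oW Wg; exact: (Cp_closure_open_seq dm dt sX oW Wg).
Qed.

Theorem corollary1p4 (R : realType) (X : topologicalType)
    (hX : completely_metrizable R X) :
  (ascoli_space R (Cp R X) <-> scattered X) /\
  (separable X ->
    (ascoli_space R (Cp R X) <-> scattered X /\ countable [set: X]%classic)).
Proof.
have AS : ascoli_space R (Cp R X) <-> scattered X.
  by split; [exact: scattered_of_ascoli_Cp|exact: ascoli_Cp_of_scattered].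
split=> // -[D cD Ddense]; split=> [/AS sX|[/AS]//]; split=> //.
have [d [dm dt _]] := hX.
(* By density [closure D] is the whole space, so its countability is that of [X]. *)
apply: sub_countable (countable_closure_scattered dm dt sX cD).
apply: subset_card_le => x _ B; rewrite nbhsE => -[Q [oQ Qx] QB].
have [y [Qy Dy]] := Ddense Q (ex_intro _ x Qx) oQ.
by exists y; split => //; exact: QB.
Qed.
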